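(* Let $Y = X\beta^* + \varepsilon$ with $Y,\varepsilon\in\mathbb{R}^n$, $X\in\mathbb{R}^{n\times p}$, $\beta^*\in\mathbb{R}^p$, let $c\in(0,2)$, and let $\Omega$ be a norm on $\mathbb{R}^p$ with dual norm $\Omega^*$. Let $\hat\beta$ be any generalized TREX estimator with constant $c$ and norm $\Omega$, and set $\hat u := \Omega^*(X^\top(Y-X\hat\beta))$. Assume that $$\Omega^*(X^\top X\beta^* )\ge\Big(1+\frac{2}{c}\Big)\Omega^*(X^\top\varepsilon).$$ If $\hat u\le\Omega^*(X^\top Y)$, then $$\frac{\|X\hat\beta-X\beta^*\|_2^2}{n}\le\frac{\big(2\,\Omega^*(X^\top\varepsilon)+\max\{\hat u,\ \tfrac{2}{c}\Omega^*(X^\top\varepsilon)\}\big)\,\Omega(\beta^* )}{n}.$$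
   Context: For a norm $\Omega$ on $\mathbb{R}^p$, the dual norm is $\Omega^*(\eta):=\sup\{\eta^\top\beta:\Omega(\beta)\le1\}$. Generalized TREX: for $c\in(0,2)$, a generalized TREX estimator is any minimizer $$\hat\beta\in\operatorname{argmin}_{\beta\in\mathbb{R}^p}\Big\{\frac{\|Y-X\beta\|_2^2}{c\,\Omega^*(X^\top(Y-X\beta))}+\Omega(\beta)\Big\},$$ where it is assumed that a minimum exists. No distributional assumption is made on $\varepsilon$ (the statement is deterministic). $\|\cdot\|_2$ is the Euclidean norm. Quotients presuppose non-zero denominators. *)

(* Defs.v *)
From HB Require Import structures.
From mathcomp Require Import all_boot all_order all_algebra.
From mathcomp Require Import classical_sets reals.

Set Implicit Arguments.
Unset Strict Implicit.
Unset Printing Implicit Defensive.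

Import Order.TTheory GRing.Theory Num.Theory.

Local Open Scope classical_set_scope.
Local Open Scope ring_scope.

(* Nonnegativity follows from the triangle inequality and homogeneity.  An
   explicit predicate is used because 'cV[R]_p already carries a canonical
   norm (the sup norm), whereas here the norm is arbitrary. *)
Record is_norm (R : realType) (p : nat) (Omega : 'cV[R]_p -> R) : Prop := IsNorm {
  is_norm_triangle : forall b1 b2, Omega (b1 + b2) <= Omega b1 + Omega b2;
  is_norm_homogeneous : forall (a : R) b, Omega (a *: b) = `|a| * Omega b;
  is_norm_definite : forall b, Omega b = 0 -> b = 0
}.

(* The set is nonempty (take beta = 0) and, when Omega is a norm, bounded
   above, since all norms on R^p are equivalent; the real-valued sup is thus a
   genuine least upper bound. *)
Definition dual_norm (R : realType) (p : nat) (Omega : 'cV[R]_p -> R)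
    (eta : 'cV[R]_p) : R :=
  sup [set (eta^T *m b) 0 0 | b in [set b : 'cV[R]_p | Omega b <= 1]].

Definition l2norm (R : realType) (n : nat) (v : 'cV[R]_n) : R :=
  Num.sqrt (\sum_(i < n) v i 0 ^+ 2).

Definition is_argmin (T : Type) (R : realType) (D : set T) (f : T -> R) (x : T)
    : Prop :=
  D x /\ forall y, D y -> f x <= f y.

Section GeneralizedTrex.
Variables (R : realType) (n p : nat).
Variables (c : R) (Omega : 'cV[R]_p -> R) (X : 'M[R]_(n, p)) (Y : 'cV[R]_n).

Definition trex_objective (b : 'cV[R]_p) : R :=
  l2norm (Y - X *m b) ^+ 2 / (c * dual_norm Omega (X^T *m (Y - X *m b)))
  + Omega b.

(* Division by zero yields 0 in MathComp, so the set on which the objective is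
   defined has to be made explicit: the minimisation ranges over the b with a
   nonzero denominator. *)
Definition trex_domain : set 'cV[R]_p :=
  [set b | c * dual_norm Omega (X^T *m (Y - X *m b)) != 0].

Definition is_generalized_trex (bhat : 'cV[R]_p) : Prop :=
  is_argmin trex_domain trex_objective bhat.

End GeneralizedTrex.

(* Main.v *)
Require Import Defs.
From mathcomp Require Import all_boot all_order all_algebra.
From mathcomp Require Import reals.
From mathcomp Require Import boolp classical_sets topology normedtype derive.
From mathcomp Require Import ring lra.

Set Implicit Arguments.
Unset Strict Implicit.
Unset Printing Implicit Defensive.

Import Order.TTheory GRing.Theory Num.Theory.
Import numFieldNormedType.Exports.

Local Open Scope ring_scope.

(** The minimality of bhat is used only against the competitor 0, whose
    objective value is |Y|^2 / (c M) with M the dual norm of X^T Y.  Put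
    e for the dual norm of X^T eps, a = <eps, X bstar>, r = Y - X bhat and
    m = max (uhat, 2 e / c).  Two facts make the comparison with 0 enough.

    - m <= M.  For uhat this is assumed; for 2 e / c it follows from the signal
      assumption, since M >= dual norm (X^T X bstar) - e.  Hence the ratio
      t = m / M lies in [0, 1].
    - |Y|^2 = <Y, eps> + <Y, X bstar>, and the duality inequality bounds the
      last term by M Omega(bstar), which after multiplication by t becomes
      m Omega(bstar); what remains is t <Y, eps> = t (|eps|^2 + a).

    Multiplying the comparison by c m, and using uhat <= m on the left, gives
    [[
      |r|^2 + c m Omega(bhat) <= m Omega(bstar) + t |eps|^2 + t a.
    ]]
    As r = eps - X (bhat - bstar), expanding |r|^2 leaves
    [[
      |X (bhat - bstar)|^2 <= m Omega(bstar) - (2 - t) a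
                              + 2 <eps, X bhat> - c m Omega(bhat).
    ]]
    The duality inequality bounds - (2 - t) a by 2 e Omega(bstar) and
    2 <eps, X bhat> by 2 e Omega(bhat), and the latter is absorbed because
    2 e <= c m.  The scalar part of this is [trex_vs_zero_bound].

    All of it rests on the duality inequality [dual_norm_holder], which needs
    the supremum defining the dual norm to be finite, that is, the unit ball of
    Omega to be bounded.  This is the half of the equivalence of norms proved
    in [sup_le_is_norm], by compactness of the unit sphere of the sup norm. *)

(** * The Euclidean inner product *)

Definition dot (R : realType) (n : nat) (u v : 'cV[R]_n) : R :=
  (u^T *m v) 0 0.

Section DotProduct.
Context {R : realType}.
Implicit Types n p : nat.

Lemma dotE n (u v : 'cV[R]_n) : dot u v = \sum_i u i 0 * v i 0.
Proof. by rewrite /dot mxE; apply: eq_bigr => i _; rewrite mxE. Qed.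

Lemma dotC n (u v : 'cV[R]_n) : dot u v = dot v u.
Proof. by rewrite !dotE; apply: eq_bigr => i _; rewrite mulrC. Qed.

Lemma dotDr n (u v w : 'cV[R]_n) : dot u (v + w) = dot u v + dot u w.
Proof. by rewrite /dot mulmxDr mxE. Qed.

Lemma dotNr n (u v : 'cV[R]_n) : dot u (- v) = - dot u v.
Proof. by rewrite /dot mulmxN mxE. Qed.

Lemma dotZr n a (u v : 'cV[R]_n) : dot u (a *: v) = a * dot u v.
Proof. by rewrite /dot -scalemxAr mxE. Qed.

Lemma dotDl n (u v w : 'cV[R]_n) : dot (u + v) w = dot u w + dot v w.
Proof. by rewrite dotC dotDr !(dotC w). Qed.

Lemma dotNl n (u v : 'cV[R]_n) : dot (- u) v = - dot u v.
Proof. by rewrite dotC dotNr dotC. Qed.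

Lemma dot_sqrB n (u v : 'cV[R]_n) :
  dot (u - v) (u - v) = dot u u - 2 * dot u v + dot v v.
Proof. by rewrite !(dotDr, dotDl, dotNr, dotNl) (dotC v u); ring. Qed.

Lemma dot_trmx n p (X : 'M[R]_(n, p)) (u : 'cV[R]_n) (b : 'cV[R]_p) :
  dot (X^T *m u) b = dot u (X *m b).
Proof. by rewrite /dot trmx_mul trmxK mulmxA. Qed.

Lemma dot_ge0 n (u : 'cV[R]_n) : 0 <= dot u u.
Proof. by rewrite dotE sumr_ge0 // => i _; rewrite -expr2 sqr_ge0. Qed.

Lemma sqr_l2norm n (u : 'cV[R]_n) : l2norm u ^+ 2 = dot u u.
Proof.
rewrite /l2norm sqr_sqrtr; last by rewrite sumr_ge0 // => i _; rewrite sqr_ge0.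
by rewrite dotE; apply: eq_bigr => i _; rewrite expr2.
Qed.

End DotProduct.

(** * Domination of the sup norm by an arbitrary norm *)

Lemma coord_le_mx_norm (R : realType) (p : nat) (v : 'rV[R]_p) i : `|v 0 i| <= `|v|.
Proof.
by rewrite [leRHS]/Num.norm /= mx_normrE; apply/bigmax_geP; right; exists (0, i).
Qed.

Section NormEquivalence.
Context {R : realType} {p : nat} {Omega : 'cV[R]_p -> R}.
Context (hOmega : is_norm Omega).

Lemma is_norm0 : Omega 0 = 0.
Proof. by rewrite -(scale0r 0) is_norm_homogeneous // normr0 mul0r. Qed.

Lemma is_normN b : Omega (- b) = Omega b.
Proof. by rewrite -scaleN1r is_norm_homogeneous // normrN1 mul1r. Qed.

Lemma is_norm_ge0 b : 0 <= Omega b.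
Proof.
have := is_norm_triangle hOmega b (- b); rewrite subrr is_norm0 is_normN.
by lra.
Qed.

Lemma is_norm_gt0 b : b != 0 -> 0 < Omega b.
Proof.
move=> b0; rewrite lt_neqAle is_norm_ge0 andbT eq_sym.
by apply: contra_neq b0; exact: is_norm_definite.
Qed.

(** Writing a vector in the canonical basis reduces the estimate to the finitely
    many values of Omega on that basis. *)
Lemma is_norm_le_sup :
  exists2 K, 0 < K & forall v : 'rV[R]_p, Omega v^T <= K * `|v|.
Proof.
have sum_ge0 : 0 <= \sum_i Omega (delta_mx i 0).
  by rewrite sumr_ge0 // => i _; exact: is_norm_ge0.
(* The summand 1 keeps the constant positive in dimension 0. *)
exists (1 + \sum_i Omega (delta_mx i 0)) => [|v]; first by lra.
apply: (@le_trans _ _ (\sum_i Omega (delta_mx i 0) * `|v|)); last first.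
  by rewrite -mulr_suml ler_wpM2r // lerDr.
have -> : v^T = \sum_i v 0 i *: delta_mx i 0.
  rewrite {1}(row_sum_delta v) linear_sum /=; apply: eq_bigr => i _.
  by rewrite linearZ /= trmx_delta.
elim/big_ind2: _ => [|b1 x1 b2 x2 h1 h2|i _]; first by rewrite is_norm0.
  by apply: le_trans (is_norm_triangle hOmega _ _) _; exact: lerD.
rewrite is_norm_homogeneous // mulrC ler_wpM2l ?is_norm_ge0 //.
exact: coord_le_mx_norm.
Qed.

(** The reverse triangle inequality makes Omega Lipschitz with the constant of
    [is_norm_le_sup].  Row vectors are used because the Heine-Borel theorem
    below is about them. *)
Lemma is_norm_continuous : continuous (fun v : 'rV[R]_p => Omega v^T).
Proof.
have [K K0 leK] := is_norm_le_sup => v.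
apply/(@cvgrPdist_le _ _ _ (nbhs v)) => e e0.
have vK : \forall w \near v, `|v - w| <= e / K.
  have ek : 0 < e / K by exact: divr_gt0.
  exact: (@cvgr_dist_le _ _ _ (nbhs v) _ id v cvg_id _ ek).
apply: filterS vK => w /=.
rewrite ler_pdivlMr // => vw; apply: le_trans vw.
have vwK := leK (v - w); rewrite linearB /= in vwK.
have h1 := is_norm_triangle hOmega (v^T - w^T) w^T.
have h2 := is_norm_triangle hOmega (- (v^T - w^T)) v^T.
rewrite is_normN opprB subrK in h2; rewrite subrK in h1.
by rewrite mulrC; apply: le_trans vwK; rewrite ler_norml; lra.
Qed.

(** Omega attains its minimum over the compact unit sphere of the sup norm; the
    minimum is positive by definiteness, and by homogeneity its inverse is a
    valid constant. *)
Lemma sup_le_is_norm :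
  exists2 C, 0 <= C & forall b : 'cV[R]_p, `|b^T| <= C * Omega b.
Proof.
pose S := [set v : 'rV[R]_p | `|v| = 1]%classic.
have normalize (b : 'cV[R]_p) : b != 0 -> S (`|b^T|^-1 *: b^T).
  move=> b0; rewrite /S /= mx_normZ normfV normr_id mulVf // normr_eq0.
  by rewrite -(inj_eq (@trmx_inj _ _ _)) trmxK trmx0.
(* In dimension 0 the sphere is empty and no minimum exists on it. *)
have [S0|noS] := pselect (S !=set0)%classic; last first.
  exists 0 => // b; have [->|b0] := eqVneq b 0; last first.
    by case: noS; exists (`|b^T|^-1 *: b^T); exact: normalize.
  by rewrite trmx0 normr0 mul0r.
have cS : compact S.
  apply: bounded_closed_compact.
    by exists 1; split=> // x x1 v /= ->; exact: ltW.
  apply: (@preimage_closed _ _ (fun v : 'rV[R]_p => `|v|)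
            [set x | x = 1]%classic).
    by move=> v _; exact: norm_continuous.
  exact: closed_eq.
have [v vS vmin] :=
  compact_EVT_min S0 cS (continuous_subspaceT is_norm_continuous).
rewrite inE /S /= in vS.
have v0 : 0 < Omega v^T.
  apply: is_norm_gt0; apply/eqP => v0.
  by move: vS; rewrite -(trmxK v) v0 trmx0 normr0 => /esym/eqP; rewrite oner_eq0.
exists (Omega v^T)^-1 => [|b]; first by rewrite invr_ge0 ltW.
have [->|b0] := eqVneq b 0; first by rewrite trmx0 normr0 is_norm0 mulr0.
have nb0 : 0 < `|b^T|.
  by rewrite normr_gt0 -(inj_eq (@trmx_inj _ _ _)) trmxK trmx0.
have /vmin : `|b^T|^-1 *: b^T \in S by rewrite inE; exact: normalize.
rewrite linearZ /= trmxK is_norm_homogeneous // normfV normr_id => vb.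
by rewrite mulrC ler_pdivlMr // mulrC -ler_pdivlMr // mulrC.
Qed.

(** * The dual norm *)

Lemma dual_norm_le eta K :
  (forall b, Omega b <= 1 -> dot eta b <= K) -> dual_norm Omega eta <= K.
Proof.
move=> leK; apply: ge_sup => [|_ [b b1 <-]]; last exact: leK.
by exists (dot eta 0), 0 => //=; rewrite is_norm0 ler01.
Qed.

(** A supremum of an unbounded set of reals is 0 by convention, so this fails
    without a bound on the unit ball; [sup_le_is_norm] bounds its
    coordinates. *)
Lemma dual_norm_ub eta b : Omega b <= 1 -> dot eta b <= dual_norm Omega eta.
Proof.
move=> b1; apply: ub_le_sup; last by exists b.
have [C C0 leC] := sup_le_is_norm.
exists (\sum_i `|eta i 0| * C) => _ [b' /= b'1 <-].
rewrite -/(dot _ _) dotE; apply: ler_sum => i _.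
apply: le_trans (ler_norm _) _; rewrite normrM ler_wpM2l //.
have := coord_le_mx_norm b'^T i; rewrite mxE => /le_trans; apply.
by apply: le_trans (leC _) _; rewrite ler_piMr.
Qed.

Lemma dual_norm_ge0 eta : 0 <= dual_norm Omega eta.
Proof.
by have := @dual_norm_ub eta 0; rewrite is_norm0 ler01 /dot mulmx0 mxE; exact.
Qed.

Lemma dual_norm_holder eta b : dot eta b <= dual_norm Omega eta * Omega b.
Proof.
have [->|b0] := eqVneq b 0; first by rewrite is_norm0 mulr0 /dot mulmx0 mxE.
have Ob := is_norm_gt0 b0.
rewrite -ler_pdivrMr // mulrC -dotZr; apply: dual_norm_ub.
by rewrite is_norm_homogeneous // normfV gtr0_norm // mulVf // gt_eqF.
Qed.

Lemma dual_norm_triangle eta1 eta2 :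
  dual_norm Omega (eta1 + eta2) <= dual_norm Omega eta1 + dual_norm Omega eta2.
Proof.
by apply: dual_norm_le => b b1; rewrite dotDl lerD // dual_norm_ub.
Qed.

Lemma dual_normN eta : dual_norm Omega (- eta) = dual_norm Omega eta.
Proof.
have le_opp eta' : dual_norm Omega (- eta') <= dual_norm Omega eta'.
  by apply: dual_norm_le => b b1; rewrite dotNl -dotNr dual_norm_ub // is_normN.
by apply/eqP; rewrite eq_le le_opp -{1}(opprK eta) le_opp.
Qed.

End NormEquivalence.

(** * Comparison of the estimator with zero *)

(** The scalar content of the comparison with the competitor 0.  Here
    u is uhat, M and e are the dual norms of X^T Y and X^T eps, Os and Oh are
    Omega(bstar) and Omega(bhat), q = |eps|^2, a = <eps, X bstar>,
    b = <eps, X bhat>, D = |X (bhat - bstar)|^2 and h = <Y, X bstar>, so that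
    q - 2 (b - a) + D is the residual |Y - X bhat|^2 and q + a + h is |Y|^2.
    The parameter m may be anything between u and M with 2 e <= c m: enlarging
    u to m weakens the comparison only on the residual term, which is
    nonnegative. *)
Lemma trex_vs_zero_bound (R : realType) (c u m M e Os Oh q a b D h : R) :
  0 < c -> 0 < u -> u <= m -> m <= M -> 2 * e <= c * m ->
  0 <= e -> 0 <= Os -> 0 <= Oh -> 0 <= q ->
  h <= M * Os -> - a <= e * Os -> b <= e * Oh ->
  0 <= q - 2 * (b - a) + D ->
  (q - 2 * (b - a) + D) / (c * u) + Oh <= (q + a + h) / (c * M) ->
  D <= (2 * e + m) * Os.
Proof.
move=> c0 u0 um mM em e0 Os0 Oh0 q0 hh ha hb.
set r := q - _ + D => r0 obj.
have m0 : 0 < m by lra.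
have M0 : 0 < M by lra.
pose t := m / M.
have t0 : 0 <= t by rewrite divr_ge0 // ltW.
have t1 : t <= 1 by rewrite ler_pdivrMr // mul1r.
have tM : t * M = m by rewrite /t mulfVK // gt_eqF.
have scaled : r + c * m * Oh <= t * (q + a + h).
  have cm0 : 0 < c * m by exact: mulr_gt0.
  have := ler_wpM2l (ltW cm0) obj; rewrite mulrDr.
  have -> : c * m * ((q + a + h) / (c * M)) = t * (q + a + h).
    by rewrite /t; field; rewrite !gt_eqF.
  apply: le_trans; rewrite lerD2r.
  have -> : c * m * (r / (c * u)) = r * (m / u) by field; rewrite !gt_eqF.
  by rewrite ler_peMr // ler_pdivlMr // mul1r.
have h1 : t * h <= m * Os by rewrite -tM -mulrA ler_wpM2l.
have h2 : t * q <= q by rewrite ler_piMl.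
have h3 : - ((2 - t) * a) <= (2 - t) * (e * Os).
  by rewrite -mulrN ler_wpM2l //; lra.
have h4 : 0 <= t * (e * Os) := mulr_ge0 t0 (mulr_ge0 e0 Os0).
have h5 : 2 * e * Oh <= c * m * Oh by rewrite ler_wpM2r.
by rewrite /r in scaled; lra.
Qed.

Theorem theorem3 (R : realType) (n p : nat)
    (X : 'M[R]_(n, p)) (Y eps : 'cV[R]_n) (bstar : 'cV[R]_p)
    (hY : Y = X *m bstar + eps)
    (c : R) (hc : 0 < c < 2)
    (Omega : 'cV[R]_p -> R) (hOmega : is_norm Omega)
    (bhat : 'cV[R]_p) (hbhat : is_generalized_trex c Omega X Y bhat)
    (uhat : R) (huhat : uhat = dual_norm Omega (X^T *m (Y - X *m bhat)))
    (hsignal : (1 + 2 / c) * dual_norm Omega (X^T *m eps)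
               <= dual_norm Omega (X^T *m X *m bstar))
    (hle : uhat <= dual_norm Omega (X^T *m Y)) :
  l2norm (X *m bhat - X *m bstar) ^+ 2 / n%:R
  <= (2 * dual_norm Omega (X^T *m eps)
      + Num.max uhat (2 / c * dual_norm Omega (X^T *m eps))) * Omega bstar
     / n%:R.
Proof.
apply: ler_wpM2r; first by rewrite invr_ge0 ler0n.
have [/= bhat_dom bhat_min] := hbhat.
have c0 : 0 < c by case/andP: hc.
(* The estimator lies in the domain of the objective, so its denominator is
   nonzero; then so is the one at 0, by uhat <= M. *)
have u0 : 0 < uhat.
  rewrite lt_neqAle huhat dual_norm_ge0 // andbT eq_sym.
  by apply: contra_neq bhat_dom => ->; rewrite mulr0.
have M0 : 0 < dual_norm Omega (X^T *m Y) by exact: lt_le_trans hle.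
have dom0 : trex_domain c Omega X Y 0.
  by rewrite /trex_domain /= mulmx0 subr0 mulf_neq0 // gt_eqF.
have {bhat_min} := bhat_min 0 dom0.
rewrite /trex_objective mulmx0 subr0 (is_norm0 hOmega) addr0 -huhat !sqr_l2norm.
set d := X *m bhat - X *m bstar; set e := dual_norm Omega (X^T *m eps).
have -> : Y - X *m bhat = eps - d.
  by rewrite hY /d opprB addrA (addrC eps).
have r0 := dot_ge0 (eps - d).
have dE : dot eps d = dot eps (X *m bhat) - dot eps (X *m bstar).
  by rewrite dotDr dotNr.
rewrite dot_sqrB dE in r0 *.
have -> : dot Y Y =
    dot eps eps + dot eps (X *m bstar) + dot Y (X *m bstar).
  by rewrite {2}hY dotDr addrC (dotC Y eps) {1}hY dotDr [X in X + _]addrC.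
have e_signal : 2 / c * e <= dual_norm Omega (X^T *m Y).
  have -> : 2 / c * e = (1 + 2 / c) * e - e by ring.
  rewrite lerBlDr; apply: le_trans hsignal _.
  (* X^T X bstar = X^T Y - X^T eps, and the dual norm is even. *)
  rewrite /e -(dual_normN hOmega (X^T *m eps)).
  rewrite -[X in dual_norm _ X <= _](addrK (X^T *m eps)).
  by rewrite -mulmxA -mulmxDr -hY dual_norm_triangle.
apply: (trex_vs_zero_bound c0 u0) r0.
- by rewrite le_max lexx.
- by rewrite ge_max hle.
- by rewrite [leRHS]mulrC -ler_pdivrMr // mulrAC le_max lexx orbT.
- exact: dual_norm_ge0.
- exact: is_norm_ge0.
- exact: is_norm_ge0.
- exact: dot_ge0.
- by rewrite -dot_trmx dual_norm_holder.
- by rewrite -dotNr -mulmxN -(is_normN hOmega) -dot_trmx dual_norm_holder.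
- by rewrite -dot_trmx dual_norm_holder.
Qed.
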